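(* Let $Q$ be a finite quandle. Then the enveloping group $G_Q$ is isomorphic to $\mathbb{Z}\times\mathbb{Z}$ if and only if $Q$ is isomorphic to $U(n,m)$ for some coprime positive integers $n,m$.
   Context: A quandle is a set $Q$ with a binary operation $*$ such that: (r1) for every $x\in Q$ the map $S_x:y\mapsto y*x$ is a bijection of $Q$; (r2) $(x*y)*z=(x*z)*(y*z)$ for all $x,y,z\in Q$; (q1) $x*x=x$ for all $x\in Q$. The enveloping group $G_Q$ of a quandle $Q$ is the group with generating set $Q$ and defining relations $x*y=y^{-1}xy$ for all $x,y\in Q$ (the left side being the generator corresponding to the element $x*y$ of $Q$). For positive integers $n,m$, $U(n,m)$ is the quandle with $n+m$ distinct elements $x_0,\dots,x_{n-1},y_0,\dots,y_{m-1}$ and operation $x_i*x_j=x_i$, $x_i*y_r=x_{i+1\,(\mathrm{mod}\ n)}$, $y_r*y_s=y_r$, $y_r*x_i=y_{r+1\,(\mathrm{mod}\ m)}$ for $i,j\in\{0,\dots,n-1\}$, $r,s\in\{0,\dots,m-1\}$. *)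

(* Defs.v *)
From HB Require Import structures.
From mathcomp Require Import all_boot all_order ssralg ssrint generic_quotient.
From mathcomp Require Import boolp.

Set Implicit Arguments.
Unset Strict Implicit.
Unset Printing Implicit Defensive.

Declare Scope quandle_scope.
Delimit Scope quandle_scope with quandle.

HB.mixin Record isQuandle (Q : Type) := {
  qop : Q -> Q -> Q;
  qop_bij : forall x, bijective (fun y => qop y x);
  qop_dist : forall x y z, qop (qop x y) z = qop (qop x z) (qop y z);
  qop_idem : forall x, qop x x = x
}.

#[short(type="quandleType")]
HB.structure Definition Quandle := {Q of isQuandle Q & Choice Q}.

#[short(type="finQuandleType")]
HB.structure Definition FinQuandle := {Q of isQuandle Q & Finite Q}.

Bind Scope quandle_scope with Quandle.sort.
Bind Scope quandle_scope with FinQuandle.sort.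
Notation "x * y" := (qop x y) : quandle_scope.

Definition quandle_iso (P Q : quandleType) : Prop :=
  exists2 f : P -> Q, bijective f & forall x y, f (x * y)%quandle = (f x * f y)%quandle.

(** The letter [(x, true)] stands for the generator [x] and [(x, false)] for
    its formal inverse. *)
Definition word (X : Type) : Type := seq (X * bool).

Definition word_inv (X : Type) (w : word X) : word X :=
  rev [seq (a.1, ~~ a.2) | a <- w].

(** [R u v] means that [u = v] is one of the defining relations. *)
Inductive pres_eq (X : Type) (R : word X -> word X -> Prop) :
    word X -> word X -> Prop :=
  | pres_refl u : pres_eq R u u
  | pres_sym u v : pres_eq R u v -> pres_eq R v u
  | pres_trans u v w : pres_eq R u v -> pres_eq R v w -> pres_eq R u w
  | pres_cat u u' v v' :
      pres_eq R u u' -> pres_eq R v v' -> pres_eq R (u ++ v) (u' ++ v')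
  | pres_cancel x b : pres_eq R [:: (x, b); (x, ~~ b)] [::]
  | pres_rel u v : R u v -> pres_eq R u v.

Section PresentedGroup.
Local Open Scope quotient_scope.
Variables (X : choiceType) (R : word X -> word X -> Prop).

Definition pres_eqb (u v : seq (X * bool)) : bool := `[< pres_eq R u v >].

Fact pres_eqb_refl : reflexive pres_eqb.
Proof. by move=> u; apply/asboolP; apply: pres_refl. Qed.

Fact pres_eqb_sym : symmetric pres_eqb.
Proof. by move=> u v; apply/asboolP/asboolP; apply: pres_sym. Qed.

Fact pres_eqb_trans : transitive pres_eqb.
Proof.
by move=> v u w /asboolP uv /asboolP vw; apply/asboolP; apply: pres_trans vw.
Qed.

Canonical pres_equiv := EquivRel pres_eqb pres_eqb_refl pres_eqb_sym pres_eqb_trans.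

Definition presented : Type := {eq_quot pres_equiv}.
HB.instance Definition _ := Choice.copy presented {eq_quot pres_equiv}.

Definition pres_class (w : word X) : presented := \pi_{eq_quot pres_equiv} w.
Definition pres_repr (g : presented) : word X :=
  repr (g : {eq_quot pres_equiv}).
Definition pres_gen (x : X) : presented := pres_class [:: (x, true)].

Lemma pres_classK g : pres_class (pres_repr g) = g.
Proof. exact: (@reprK _ {eq_quot pres_equiv}). Qed.

Lemma pres_classP u v : pres_class u = pres_class v <-> pres_eq R u v.
Proof. by split=> [/eqmodP/asboolP | uv] //; apply/eqmodP/asboolP. Qed.

Lemma pres_reprK w : pres_eq R (pres_repr (pres_class w)) w.
Proof. by apply/pres_classP; rewrite pres_classK. Qed.

Lemma pres_eq_invr w : pres_eq R (w ++ word_inv w) [::].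
Proof.
elim: w => [|[x b] w IHw]; first exact: pres_refl.
rewrite /word_inv /= rev_cons -cats1 catA -cat1s.
apply: pres_trans (pres_cancel R x b).
rewrite -(cat1s (x, b) [:: _]); apply: pres_cat (pres_refl _ _) _.
rewrite -[X in pres_eq R _ X]cat0s.
exact: pres_cat IHw (pres_refl _ _).
Qed.

Lemma word_invK : involutive (@word_inv X).
Proof.
move=> w; rewrite /word_inv map_rev revK -map_comp.
by rewrite -[RHS]map_id; apply: eq_map => -[x b] /=; rewrite negbK.
Qed.

Lemma pres_eq_invl w : pres_eq R (word_inv w ++ w) [::].
Proof. by rewrite -[X in _ ++ X]word_invK; apply: pres_eq_invr. Qed.

Definition pres_one : presented := pres_class [::].
Definition pres_mul (g h : presented) : presented :=
  pres_class (pres_repr g ++ pres_repr h).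
Definition pres_inv (g : presented) : presented :=
  pres_class (word_inv (pres_repr g)).

Fact pres_class_mul u v :
  pres_mul (pres_class u) (pres_class v) = pres_class (u ++ v).
Proof. by apply/pres_classP/pres_cat; apply: pres_reprK. Qed.

Fact pres_mulA : associative pres_mul.
Proof.
move=> f g h; rewrite -[f]pres_classK -[g]pres_classK -[h]pres_classK.
by rewrite !pres_class_mul catA.
Qed.

Fact pres_mul1 : left_id pres_one pres_mul.
Proof. by move=> g; rewrite -[g]pres_classK pres_class_mul. Qed.

Fact pres_mulr1 : right_id pres_one pres_mul.
Proof. by move=> g; rewrite -[g]pres_classK pres_class_mul cats0. Qed.

Fact pres_mulV : left_inverse pres_one pres_inv pres_mul.
Proof.
move=> g; rewrite -{2}[g]pres_classK pres_class_mul.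
exact/pres_classP/pres_eq_invl.
Qed.

Fact pres_mulrV : right_inverse pres_one pres_inv pres_mul.
Proof.
move=> g; rewrite -{1}[g]pres_classK pres_class_mul.
exact/pres_classP/pres_eq_invr.
Qed.

HB.instance Definition _ := isGroup.Build presented
  pres_mulA pres_mul1 pres_mulr1 pres_mulV pres_mulrV.

Local Open Scope group_scope.

Lemma pres_classM u v : pres_class (u ++ v) = pres_class u * pres_class v.
Proof. by rewrite -pres_class_mul. Qed.

Lemma pres_genV x : pres_class [:: (x, false)] = (pres_gen x)^-1.
Proof.
apply: (mulgI (pres_gen x)); rewrite mulgV -pres_classM.
exact/pres_classP/pres_cancel.
Qed.

Definition word_eval (H : groupType) (f : X -> H) (w : word X) : H :=
  \prod_(a <- w) (if a.2 then f a.1 else (f a.1)^-1).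

Lemma presented_universal (H : groupType) (f : X -> H) :
    (forall u v, R u v -> word_eval f u = word_eval f v) ->
  exists2 F : {multiplicative presented -> H},
    forall x, F (pres_gen x) = f x &
    forall F' : {multiplicative presented -> H},
      (forall x, F' (pres_gen x) = f x) -> F' =1 F.
Proof.
move=> fR.
have evR u v : pres_eq R u v -> word_eval f u = word_eval f v.
  elim=> {u v} [//|u v _ -> //|u v w _ -> _ -> //|u u' v v' _ eu _ ev|x b|].
  - by rewrite /word_eval !big_cat -!/(word_eval _ _) eu ev.
  - rewrite /word_eval !big_cons !big_nil mulg1 /=.
    by case: b; rewrite /= ?mulgV ?mulVg.
  - exact: fR.
pose F0 g := word_eval f (pres_repr g).
have F0E w : F0 (pres_class w) = word_eval f w by apply/evR/pres_reprK.
have F0M : {morph F0 : g h / g * h}.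
  move=> g h; rewrite -[g]pres_classK -[h]pres_classK -pres_classM !F0E.
  by rewrite /word_eval big_cat.
pose Fm := isMultiplicative.Build presented H F0 F0M.
pose F : {multiplicative presented -> H} := HB.pack F0 Fm.
exists F => [x|F' F'f g]; first by rewrite /= F0E /word_eval big_seq1.
have F'1 : F' (1 : presented) = 1.
  by apply: (mulgI (F' 1)); rewrite -gmulfM !mulg1.
have F'V h : F' (h^-1) = (F' h)^-1.
  by apply: (mulgI (F' h)); rewrite -gmulfM !mulgV.
rewrite -[g]pres_classK /= F0E.
elim: (pres_repr g) => [|[x b] w IHw]; first by rewrite /word_eval big_nil.
rewrite -cat1s pres_classM gmulfM IHw /word_eval big_cons /=; congr (_ * _).
by case: b; rewrite -?F'f // pres_genV F'V.
Qed.

End PresentedGroup.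

Definition enveloping_rel (Q : quandleType) (u v : word Q) : Prop :=
  exists x y : Q,
    u = [:: ((x * y)%quandle, true)] /\
    v = [:: (y, false); (x, true); (y, true)].

Definition enveloping_group (Q : quandleType) : groupType :=
  presented (@enveloping_rel Q).

Lemma enveloping_gen_conj (Q : quandleType) (x y : Q) :
  pres_gen (@enveloping_rel Q) (x * y)%quandle =
  (pres_gen (@enveloping_rel Q) x ^ pres_gen (@enveloping_rel Q) y)%g.
Proof.
rewrite conjgE -pres_genV.
transitivity (pres_class (@enveloping_rel Q) [:: (y, false); (x, true); (y, true)]).
  by apply/pres_classP; apply: pres_rel; exists x, y.
by rewrite -(cat1s (y, false)) pres_classM -(cat1s (x, true) [:: _]) pres_classM.
Qed.

Definition group_iso (G H : groupType) : Prop :=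
  exists f : {multiplicative G -> H}, bijective f.

(** [int] is additive; [Algebra.to_multiplicative] turns its sum into a group law. *)
Definition ZxZ : groupType :=
  (Algebra.to_multiplicative int * Algebra.to_multiplicative int)%type.

(** [inl i] is x_i, [inr r] is y_r, and [ordS i] is i + 1 modulo n. *)
Definition U (n m : nat) : Type := ('I_n + 'I_m)%type.

Definition U_op (n m : nat) (a b : U n m) : U n m :=
  match a, b with
  | inl i, inl _ => inl i
  | inl i, inr _ => inl (ordS i)
  | inr r, inr _ => inr r
  | inr r, inl _ => inr (ordS r)
  end.

Section UQuandle.
Variables n m : nat.

HB.instance Definition _ := Finite.on (U n m).

Fact U_op_bij (b : U n m) : bijective (fun a => U_op a b).
Proof.
case: b => [j|s].
- exists (fun a : U n m => if a is inr r then inr (ord_pred r) else a).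
  + by case=> //= r; rewrite ordSK.
  + by case=> //= r; rewrite ord_predK.
- exists (fun a : U n m => if a is inl i then inl (ord_pred i) else a).
  + by case=> //= i; rewrite ordSK.
  + by case=> //= i; rewrite ord_predK.
Qed.

Fact U_op_dist (a b c : U n m) :
  U_op (U_op a b) c = U_op (U_op a c) (U_op b c).
Proof. by case: a; case: b; case: c. Qed.

Fact U_op_idem (a : U n m) : U_op a a = a.
Proof. by case: a. Qed.

HB.instance Definition _ := isQuandle.Build (U n m) U_op_bij U_op_dist U_op_idem.

End UQuandle.

(* Main.v *)
(** If [G_Q] is [Z x Z], it is commutative, so the generators are constant on
    the orbits of [Q], and so are the translations [S_x], because [G_Q] acts on
    [Q].  Integer-valued functions invariant under the operation are the
    homomorphisms from [G_Q] to [Z], hence there are exactly two orbits; the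
    translation by a point fixes the orbit of this point and is a cycle on the
    other one, that is, [Q] is some [U(n, m)].  Sending [x_i] to [x c^i] and
    [y_r] to [y c^-r], with [c] the central commutator of [x] and [y], maps
    [G_Q] to a nonabelian Heisenberg group modulo [gcd(n, m)] unless [n] and [m]
    are coprime.
    Conversely, in the enveloping group of [U(n, m)] the commutator
    [c = [x_i, y_r]] equals both [x_i^-1 x_{i+1}] and [y_{r+1}^-1 y_r], so it
    does not depend on [i] and [r], and going round both cycles gives
    [c^n = c^m = 1], whence [c = 1] when [n] and [m] are coprime. *)
Require Import Defs.
From HB Require Import structures.
From mathcomp Require Import all_boot all_order all_fingroup all_algebra ring.

Set Implicit Arguments.
Unset Strict Implicit.
Unset Printing Implicit Defensive.

Import GRing.Theory.
Local Open Scope group_scope.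

(** * Homomorphisms out of the enveloping group *)

Local Notation gen := (pres_gen (@enveloping_rel _)).
Lemma multiplicative1 (G H : groupType) (F : {multiplicative G -> H}) : F 1 = 1.
Proof. by apply: (mulgI (F 1)); rewrite -gmulfM !mulg1. Qed.

Definition umagma_hom (G H : groupType) (F : {multiplicative G -> H}) :
    UMagmaMorphism.type G H :=
  HB.pack (F : G -> H) (isMultiplicative.Build G H F (@gmulfM G H F))
    (Multiplicative_isUMagmaMorphism.Build G H F (multiplicative1 F)).

Lemma enveloping_lift (Q : quandleType) (H : groupType) (f : Q -> H) :
    (forall x y, f (x * y)%quandle = f x ^ f y) ->
  exists F : {multiplicative enveloping_group Q -> H}, forall x, F (gen x) = f x.
Proof.
move=> fJ; case: (@presented_universal Q (@enveloping_rel Q) H f) => [|F FE _].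
  move=> _ _ [x [y [-> ->]]].
  by rewrite /word_eval !big_cons big_nil /= !mulg1 fJ conjgE.
by exists F.
Qed.

(** Uniqueness in the universal property, for the map [x |-> F' (gen x)]: [F] and [F'] both extend
    it. *)
Lemma enveloping_hom_eq (Q : quandleType) (H : groupType)
    (F F' : {multiplicative enveloping_group Q -> H}) :
  (forall x, F (gen x) = F' (gen x)) -> F =1 F'.
Proof.
move=> eqF; have F'J x y : F' (gen (x * y)%quandle) = F' (gen x) ^ F' (gen y).
  by rewrite enveloping_gen_conj (gmulfJ (umagma_hom F')).
case: (@presented_universal Q (@enveloping_rel Q) H (fun x => F' (gen x))).
  move=> _ _ [x [y [-> ->]]].
  by rewrite /word_eval !big_cons big_nil /= !mulg1 F'J conjgE.
by move=> F0 _ F0E g; rewrite (F0E F) // (F0E F').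
Qed.

Lemma enveloping_ind (Q : quandleType) (P : enveloping_group Q -> Prop) :
    P 1 -> (forall x g, P g -> P (gen x * g)) ->
  (forall x g, P g -> P ((gen x)^-1 * g)) -> forall g, P g.
Proof.
move=> P1 PM PV g; rewrite -[g]pres_classK.
elim: (pres_repr g) => [//|[x b] w IHw].
rewrite -cat1s pres_classM; case: b; first exact: PM.
by rewrite pres_genV; apply: PV.
Qed.

(** * Integer powers and homomorphisms on Z x Z *)

Definition expgz (G : groupType) (x : G) (z : int) : G :=
  match z with Posz n => x ^+ n | Negz n => x ^- n.+1 end.

Section IntegerPowers.
Variable G : groupType.
Implicit Types (x y : G) (z : int).

Lemma expgz_succ x z : expgz x (z + 1)%R = x * expgz x z.
Proof.
case: z => [n|[|n]]; first by rewrite -PoszD addn1 /= expgS.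
  by rewrite /= expg1 mulgV.
have -> : (Negz n.+1 + 1 = Negz n)%R.
  by rewrite !NegzE -(addn1 n.+1) PoszD opprD addrNK.
by rewrite /= (expgSr x n.+1) invgM mulVKg.
Qed.

Lemma expgz_pred x z : expgz x (z - 1)%R = x^-1 * expgz x z.
Proof. by rewrite -{2}(subrK 1%R z) expgz_succ mulKg. Qed.

Lemma commute_expgz x y z : commute x y -> commute x (expgz y z).
Proof. by case: z => n cxy; [apply: commuteX | apply/commuteV/commuteX]. Qed.

Lemma gmulf_expgz (H : groupType) (F : {multiplicative G -> H}) x z :
  F (expgz x z) = expgz (F x) z.
Proof.
case: z => n; first exact: (gmulfXn (umagma_hom F)).
exact: (gmulfXVn (umagma_hom F)).
Qed.
End IntegerPowers.

Local Notation Zmul := (Algebra.to_multiplicative int : groupType).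

Lemma expgz_int (a : Zmul) z : expgz a z = (z * (a : int))%R.
Proof.
elim/int_ind: z => [|n IH|n IH]; first by rewrite mul0r.
- by rewrite -addn1 PoszD expgz_succ IH mulrDl mul1r addrC.
- by rewrite -addn1 PoszD opprD expgz_pred IH mulrDl mulN1r addrC.
Qed.

Definition e1 : ZxZ := (1%R, 0%R).
Definition e2 : ZxZ := (0%R, 1%R).

Lemma ZxZ_expgz (p : ZxZ) : p = expgz e1 p.1 * expgz e2 p.2.
Proof.
have E (q : ZxZ) z : expgz q z = (expgz q.1 z, expgz q.2 z) :> ZxZ.
  elim/int_ind: z => [//|n IH|n IH].
    by rewrite -addn1 PoszD !expgz_succ IH.
  by rewrite -addn1 PoszD opprD !expgz_pred IH.
case: p => a b; rewrite !E; congr pair.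
  by rewrite /= !expgz_int mulr1 mulr0; apply/esym/addr0.
by rewrite /= !expgz_int mulr1 mulr0; apply/esym/add0r.
Qed.

Lemma ZxZ_hom_int (F : {multiplicative ZxZ -> Zmul}) (p : ZxZ) :
  F p = (p.1 * (F e1 : int) + p.2 * (F e2 : int))%R.
Proof. by rewrite [p in LHS]ZxZ_expgz gmulfM !gmulf_expgz !expgz_int. Qed.

Lemma ZxZ_commute (p q : ZxZ) : commute p q.
Proof. by congr pair; apply: addrC. Qed.

(** * The enveloping group of U(n, m) for coprime n and m *)

Lemma expg_coprime_eq1 (G : groupType) (c : G) n m :
  0 < n -> 0 < m -> coprime n m -> c ^+ n = 1 -> c ^+ m = 1 -> c = 1.
Proof.
move=> n0 m0 /(coprimeP m n0)[u uE] cn cm.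
(* The Bezout identity [uE] uses truncated subtraction; its value 1 is positive, so no truncation
   occurs. *)
have lt_u : (u.2 * m <= u.1 * n)%N by rewrite ltnW // -subn_gt0 uE.
rewrite -[c]expg1 -uE expgnFr // mulnC expgnA cn mulnC expgnA cm.
by rewrite !expg1n mulgV.
Qed.

Lemma iter_ordS n (i : 'I_n) k : iter k (@ordS n) i = (i + k) %% n :> nat.
Proof.
elim: k => [|k IH]; first by rewrite addn0 modn_small.
by rewrite iterS /= IH -addn1 modnDml addn1 addnS.
Qed.

Lemma iter_ordS_id n (i : 'I_n) : iter n (@ordS n) i = i.
Proof. by apply: val_inj; rewrite /= iter_ordS modnDr modn_small. Qed.

Lemma ordS_invariant n (T : Type) (f : 'I_n -> T) :
  (forall i, f (ordS i) = f i) -> forall i j, f i = f j.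
Proof.
move=> fS i j; have fiter k l : f (iter k (@ordS n) l) = f l.
  by elim: k => //= k IH; rewrite fS.
(* [j - i] steps lead from [i] to [j]; the added full turn [n] keeps the difference nonnegative. *)
rewrite -(fiter (j + n - i)%N i); congr f; apply: val_inj => /=.
have lt_i : i <= j + n by rewrite ltnW // ltn_addl.
by rewrite iter_ordS subnKC // modnDr modn_small.
Qed.

Section UEnveloping.
Variables (Q : quandleType) (n m : nat) (f : U n m -> Q).
Hypotheses (n_gt0 : 0 < n) (m_gt0 : 0 < m) (co_nm : coprime n m).
Hypothesis fM : forall a b, f (a * b)%quandle = (f a * f b)%quandle.

Let x i := gen (f (inl i)).
Let y r := gen (f (inr r)).

Let xS i r : x (ordS i) = x i ^ y r.
Proof. by rewrite -enveloping_gen_conj -fM. Qed.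

Let yS i r : y (ordS r) = y r ^ x i.
Proof. by rewrite -enveloping_gen_conj -fM. Qed.

(** The form [(x i)^-1 * x (ordS i)] does not involve [r], and [(y (ordS r))^-1 * y r] does not
    involve [i]. *)
Let commxy_const i j r s : [~ x i, y r] = [~ x j, y s].
Proof.
rewrite commgEl -xS (xS i s) -commgEl commgEr conjVg -yS (yS j).
by rewrite -conjVg -commgEr.
Qed.

Lemma U_gen_commute i r : commute (x i) (y r).
Proof.
apply/commgP/eqP; set c := [~ _, _]; apply: (expg_coprime_eq1 n_gt0 m_gt0 co_nm).
(* Each step multiplies by the commutator at the current index, which is again [c]; centrality of
   [c] is not invoked. *)
- have xiter k : x (iter k (@ordS n) i) = x i * c ^+ k.
    elim: k => [|k IH]; first by rewrite mulg1.
    rewrite iterS expgSr mulgA -IH (xS _ r) conjgE.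
    by rewrite /c (commxy_const i (iter k (@ordS n) i) r r) commgEl mulVKg conjgE.
  by apply: (mulgI (x i)); rewrite -xiter iter_ordS_id mulg1.
- have yiter k : y (iter k (@ordS m) r) * c ^+ k = y r.
    elim: k => [|k IH]; first by rewrite mulg1.
    rewrite iterS expgS mulgA (yS i) -[RHS]IH; congr (_ * _).
    rewrite /c (commxy_const i i r (iter k (@ordS m) r)) commgEr conjVg.
    by rewrite mulVKg.
  by apply: (mulgI (y r)); rewrite -{1}(iter_ordS_id r) yiter mulg1.
Qed.

Lemma U_gen_inl i j : x i = x j.
Proof.
apply: ordS_invariant => k; rewrite (xS _ (Ordinal m_gt0)) conjgE.
by rewrite U_gen_commute mulKg.
Qed.

Lemma U_gen_inr r s : y r = y s.
Proof.
apply: ordS_invariant => k; rewrite (yS (Ordinal n_gt0)) conjgE.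
by rewrite -U_gen_commute mulKg.
Qed.

Lemma U_enveloping_ZxZ : bijective f -> group_iso (enveloping_group Q) ZxZ.
Proof.
case=> g fK gK; pose X := x (Ordinal n_gt0); pose Y := y (Ordinal m_gt0).
have cXY : commute X Y by apply: U_gen_commute.
have genE q : gen q = if g q is inl _ then X else Y.
  by rewrite -{1}(gK q); case: (g q) => j; [apply: U_gen_inl | apply: U_gen_inr].
have [|F FE] := @enveloping_lift Q ZxZ (fun q => if g q is inl _ then e1 else e2).
  move=> p q; rewrite conjgE (ZxZ_commute _ (if g q is inl _ then _ else _)) mulKg.
  by rewrite -{1}(gK p) -{1}(gK q) -fM fK; case: (g p) => ?; case: (g q).
pose H (p : ZxZ) := expgz X p.1 * expgz Y p.2.
have HK : cancel H F.
  move=> p; rewrite gmulfM !gmulf_expgz !FE !fK /=.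
  by rewrite -ZxZ_expgz.
(* With [HK], surjectivity makes [H] a two-sided inverse, so [H] need not be shown
   multiplicative. *)
have H_surj h : exists p, h = H p.
  elim/enveloping_ind: h => [|q _ [p ->]|q _ [p ->]].
  - by exists 1; rewrite /H mulg1.
  - rewrite genE /H; case: (g q) => _.
      by exists ((p.1 + 1)%R, p.2); rewrite expgz_succ mulgA.
    exists (p.1, (p.2 + 1)%R); rewrite expgz_succ !mulgA; congr (_ * _).
    exact/commute_expgz/commute_sym.
  - rewrite genE /H; case: (g q) => _.
      by exists ((p.1 - 1)%R, p.2); rewrite expgz_pred mulgA.
    exists (p.1, (p.2 - 1)%R); rewrite expgz_pred !mulgA; congr (_ * _).
    by apply/commute_sym/commuteV/commute_sym/commute_expgz/commute_sym.
exists F, H => // h; have [p ->] := H_surj h.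
by rewrite HK.
Qed.

End UEnveloping.

(** * A Heisenberg group modulo k + 2, acting on pairs *)

Section Heisenberg.
Variable k : nat.
(** A modulus of at least 2 gives a ring with [1 != 0], which keeps the group nonabelian. *)
Let Z := 'I_k.+2.
Implicit Types (t : Z) (w : Z * Z).
Local Open Scope ring_scope.

Fact heis_x_inj t : injective (fun w => (w.1 + 1, w.2 + t)).
Proof. by move=> [u v] [u' v'] /pair_equal_spec[/= /addIr -> /addIr ->]. Qed.

Fact heis_y_inj t : injective (fun w => (w.1, w.2 + w.1 - t)).
Proof. by move=> [u v] [u' v'] /pair_equal_spec[/= -> /addIr/addIr ->]. Qed.

(* The elements [x c^t] and [y c^-t] of the Heisenberg group modulo [k.+2], where
   [c] is the translation [(u, v) |-> (u, v + 1)]. *)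
Definition heis_x t : {perm Z * Z} := perm (@heis_x_inj t).
Definition heis_y t : {perm Z * Z} := perm (@heis_y_inj t).

Lemma heis_xx t s : (heis_x t ^ heis_x s)%g = heis_x t.
Proof.
rewrite conjgE; apply: (mulgI (heis_x s)); rewrite mulVKg.
by apply/permP => -[u v]; rewrite !permM !permE /=; congr pair; ring.
Qed.

Lemma heis_yy t s : (heis_y t ^ heis_y s)%g = heis_y t.
Proof.
rewrite conjgE; apply: (mulgI (heis_y s)); rewrite mulVKg.
by apply/permP => -[u v]; rewrite !permM !permE /=; congr pair; ring.
Qed.

Lemma heis_xy t s : (heis_x t ^ heis_y s)%g = heis_x (t + 1).
Proof.
rewrite conjgE; apply: (mulgI (heis_y s)); rewrite mulVKg.
by apply/permP => -[u v]; rewrite !permM !permE /=; congr pair; ring.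
Qed.

Lemma heis_yx t s : (heis_y t ^ heis_x s)%g = heis_y (t + 1).
Proof.
rewrite conjgE; apply: (mulgI (heis_x s)); rewrite mulVKg.
by apply/permP => -[u v]; rewrite !permM !permE /=; congr pair; ring.
Qed.

Lemma heis_not_commute t s : ~ commute (heis_x t) (heis_y s).
Proof.
(* The two products send [(0, 0)] to [(1, t + 1 - s)] and [(1, t - s)]. *)
move/permP/(_ (0, 0)); rewrite !permM !permE /= => /pair_equal_spec[_ /eqP].
rewrite -subr_eq0 => /eqP E.
have : (1 : Z) == 0 by rewrite -E; apply/eqP; ring.
by rewrite oner_eq0.
Qed.

(** The wrap-around of [ordS] subtracts [n], which vanishes modulo [k.+2]; thus indices modulo [n]
    can serve as Heisenberg parameters. *)
Lemma natr_ordS n (i : 'I_n) : (k.+2 %| n)%N -> (ordS i)%:R = i%:R + 1 :> Z.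
Proof.
move=> dv; rewrite natr1 [in RHS](divn_eq i.+1 n) natrD natrM.
suff -> : n%:R = 0 :> Z by rewrite mulr0 add0r.
case/dvdnP: dv => q ->; rewrite natrM [k.+2%:R](_ : _ = 0) ?mulr0 //.
exact: (@pchar_Zp k.+2).
Qed.

End Heisenberg.

Lemma U_commute_coprime (Q : quandleType) n m (f : Q -> U n m) :
    0 < n -> 0 < m -> bijective f ->
    (forall p q, f (p * q)%quandle = (f p * f q)%quandle) ->
    (forall g h : enveloping_group Q, commute g h) ->
  coprime n m.
Proof.
move=> n0 m0 [g fK gK] fM cG; apply/eqP; move dE: (gcdn n m) => d.
(* The gcd is positive, and the value 1 is the goal; there remains [d = k.+2]. *)
case: d dE => [|[//|k]] dE; first by move: (gcdn_gt0 n m); rewrite dE n0.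
have dn : k.+2 %| n by rewrite -dE dvdn_gcdl.
have dm : k.+2 %| m by rewrite -dE dvdn_gcdr.
pose h (u : U n m) : {perm 'I_k.+2 * 'I_k.+2} :=
  match u with inl i => heis_x (i%:R)%R | inr r => heis_y (r%:R)%R end.
have [|F FE] := @enveloping_lift Q {perm 'I_k.+2 * 'I_k.+2} (h \o f).
  move=> p q /=; rewrite fM; case: (f p) => i; case: (f q) => j /=.
  - by rewrite heis_xx.
  - by rewrite natr_ordS // -(heis_xy _ (j%:R)%R).
  - by rewrite natr_ordS // -(heis_yx _ (j%:R)%R).
  - by rewrite heis_yy.
pose X := gen (g (inl (Ordinal n0))); pose Y := gen (g (inr (Ordinal m0))).
by have := gmulf_commute F (cG X Y); rewrite !FE /= !gK /= => /heis_not_commute.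
Qed.

(** * Orbits and translations of a finite quandle *)

Lemma iter_order_modn (T : finType) (f : T -> T) (a : T) (i : 'I_(fingraph.order f a)) :
  injective f -> iter (ordS i) f a = f (iter i f a).
Proof.
move=> f_inj; rewrite -iterS [nat_of_ord (ordS i)]/=; have := ltn_ord i.
rewrite leq_eqVlt.
case/predU1P => [->|lti]; first by rewrite modnn iter_order.
by rewrite modn_small.
Qed.

Section Orbits.
Variable Q : finQuandleType.
Implicit Types x y z a b : Q.

(* Both directions are included, so that symmetry of the closure is immediate. *)
Definition qstep : rel Q :=
  [rel x y | [exists z, ((x * z)%quandle == y) || ((y * z)%quandle == x)]].
Definition qconn : rel Q := connect qstep.

Lemma qstep_op x z : qstep x (x * z)%quandle.
Proof. by apply/existsP; exists z; rewrite eqxx. Qed.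

Lemma qconn_sym : symmetric qconn.
Proof.
apply: sym_connect_sym => x y; apply/existsP/existsP => -[z xyz]; exists z;
by rewrite orbC.
Qed.

Lemma qconn_op a x z : qconn a (x * z)%quandle = qconn a x.
Proof. exact/esym/(same_connect1r qconn_sym)/qstep_op. Qed.

Lemma qconn_invariant (T : Type) (k : Q -> T) x y :
  (forall x z, k (x * z)%quandle = k x) -> qconn x y -> k x = k y.
Proof.
move=> kop /connectP[p xp ->]; elim: p x xp => //= z p IH x /andP[/existsP[w xz]].
by move/IH <-; case/orP: xz => /eqP <-; rewrite kop.
Qed.

Lemma qconn_iter a b i : qconn a (iter i (fun x => x * b)%quandle a).
Proof. by elim: i => [|i IH]; [apply: connect0 | rewrite iterS qconn_op]. Qed.

Lemma qop_inj b : injective (fun x => x * b)%quandle.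
Proof. exact/bij_inj/qop_bij. Qed.

Definition qaction_perm z : {perm Q} := perm (@qop_inj z).

(** By self-distributivity the translations satisfy the defining relations, so [S_y] is the image of
    [gen y] under a homomorphism to the permutations of [Q]. *)
Lemma gen_eq_qop y z x : gen y = gen z -> (x * y = x * z)%quandle.
Proof.
have [|F FE] := @enveloping_lift Q {perm Q} qaction_perm.
  move=> y' z'; rewrite conjgE; apply: (mulgI (qaction_perm z')).
  by rewrite mulVKg; apply/permP => t; rewrite !permM !permE -qop_dist.
by move=> /(congr1 F); rewrite !FE => /permP/(_ x); rewrite !permE.
Qed.

Hypothesis G_commute : forall g h : enveloping_group Q, commute g h.

Lemma gen_op x z : gen (x * z)%quandle = gen x.
Proof. by rewrite enveloping_gen_conj conjgE G_commute mulgK. Qed.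

Lemma qconn_qop x y z : qconn y z -> (x * y = x * z)%quandle.
Proof. by move=> yz; apply/gen_eq_qop/(qconn_invariant gen_op). Qed.

(** On a single orbit [S_y = S_x], and [S_x] fixes [x] by idempotence. *)
Lemma qconn_fix a x y : qconn a x -> qconn a y -> (x * y)%quandle = x.
Proof.
rewrite qconn_sym => xa ay.
by rewrite -(qconn_qop x (connect_trans xa ay)) qop_idem.
Qed.

Section TwoOrbits.
Variables a b : Q.
Hypothesis cover : forall c, qconn a c || qconn b c.

(** Inside the orbit of [a], every translation is either the identity or [S_b], so the [S_b]-cycle
    of [a] is closed under all of them. *)
Lemma qconn_fconnect x : qconn a x -> fconnect (fun x => x * b)%quandle a x.
Proof.
(* The conjunct [qconn a x] confines the check of invariance to the orbit of [a]. *)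
move=> ax; pose k x := qconn a x && fconnect (fun x => x * b)%quandle a x.
suff: k x by case/andP.
rewrite -(@qconn_invariant _ k a x _ ax) {}/k => [|{ax}x z].
  by rewrite /qconn !connect0.
rewrite qconn_op; case ax: (qconn a x) => //=; case/orP: (cover z) => [az|bz].
  by rewrite (qconn_fix ax az).
rewrite -(qconn_qop x bz); apply/esym.
exact: (same_fconnect1_r (@qop_inj b)).
Qed.

End TwoOrbits.

Lemma two_orbits_U a b :
    ~~ qconn a b -> (forall c, qconn a c || qconn b c) ->
  exists n m, [/\ 0 < n, 0 < m & quandle_iso Q (U n m)].
Proof.
move=> nab cover; pose t x := (x * b)%quandle; pose s x := (x * a)%quandle.
have t_inj : injective t := @qop_inj b.
have s_inj : injective s := @qop_inj a.
(* The cycle lengths of [a] under [S_b] and of [b] under [S_a]. *)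
exists (fingraph.order t a), (fingraph.order s b); split; [exact: fingraph.order_gt0 .. |].
pose f (u : U (fingraph.order t a) (fingraph.order s b)) : Q :=
  match u with inl i => iter i t a | inr r => iter r s b end.
have fa i : qconn a (f (inl i)) by apply: qconn_iter.
have fb r : qconn b (f (inr r)) by apply: qconn_iter.
have fab i r : f (inl i) <> f (inr r).
  move=> E; case/negP: nab; apply: connect_trans (fa i) _.
  by rewrite E -[connect _ _ _]/(qconn _ _) qconn_sym.
have f_inj : injective f.
  case=> [i|r] [j|q] E.
  - congr inl; apply: val_inj.
    by rewrite -[val i](findex_iter (ltn_ord i)) [iter i _ _]E findex_iter.
  - by case: (fab _ _ E).
  - by case: (fab _ _ (esym E)).
  - congr inr; apply: val_inj.
    by rewrite -[val r](findex_iter (ltn_ord r)) [iter r _ _]E findex_iter.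
have f_surj x : exists u, f u == x.
  case/orP: (cover x) => [ax|bx].
    have tx := qconn_fconnect cover ax.
    by exists (inl (Ordinal (findex_max tx))); rewrite /= iter_findex.
  have cover' c : qconn b c || qconn a c by rewrite orbC.
  have sx := qconn_fconnect cover' bx.
  by exists (inr (Ordinal (findex_max sx))); rewrite /= iter_findex.
pose g x := xchoose (f_surj x).
have gK : cancel g f by move=> x; apply/eqP/(xchooseP (f_surj x)).
have fK : cancel f g by move=> u; apply: f_inj; rewrite gK.
have fM u v : f (u * v)%quandle = (f u * f v)%quandle.
  case: u v => [i|r] [j|q].
  - by rewrite (qconn_fix (fa i) (fa j)).
  - by rewrite -(qconn_qop _ (fb q)); apply: iter_order_modn.
  - by rewrite -(qconn_qop _ (fa j)); apply: iter_order_modn.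
  - by rewrite (qconn_fix (fb r) (fb q)).
by exists g => [|x y]; [exists f | apply: f_inj; rewrite fM !gK].
Qed.

(** * Counting the orbits *)

Variables (K : {multiplicative enveloping_group Q -> ZxZ}).
Variable L : ZxZ -> enveloping_group Q.
Hypotheses (KK : cancel K L) (LK : cancel L K).

(** Such a [k] extends to a homomorphism to Z; composed with [L] it is a linear form on Z x Z, with
    coefficients [u] and [v]. *)
Lemma invariant_rank2 (k : Q -> int) :
    (forall x z, k (x * z)%quandle = k x) ->
  exists u v : int, forall x, k x = ((K (gen x)).1 * u + (K (gen x)).2 * v)%R.
Proof.
move=> kop; have [|F FE] := @enveloping_lift Q Zmul k.
  move=> x y; rewrite kop conjgE; apply: (mulgI (k y : Zmul)); rewrite mulVKg.
  exact: addrC.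
pose LM := isMultiplicative.Build ZxZ (enveloping_group Q) L (can2_gmulfM KK LK).
pose L' : {multiplicative ZxZ -> enveloping_group Q} := HB.pack L LM.
exists (F (L e1)), (F (L e2)) => x; rewrite -FE -{1}(KK (gen x)).
exact: (ZxZ_hom_int (F \o L')).
Qed.

(** Otherwise a linear form vanishing at [p] would kill the images of all generators, hence all of Z
    x Z. *)
Lemma gen_not_const (p : ZxZ) : ~ forall x : Q, K (gen x) = p.
Proof.
move=> Kp.
have lin (u v : int) : (p.1 * u + p.2 * v = 0)%R ->
    forall q : ZxZ, ((q.1 : int) * u + (q.2 : int) * v = 0)%R.
  move=> puv q; pose l (q : ZxZ) : Zmul := ((q.1 : int) * u + (q.2 : int) * v)%R.
  have lM : {morph l : g h / g * h}.
    move=> [q1 q2] [r1 r2].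
    transitivity ((q1 + r1 : int) * u + (q2 + r2 : int) * v)%R => //.
    by rewrite !mulrDl addrACA.
  pose lm : {multiplicative ZxZ -> Zmul} :=
    HB.pack l (isMultiplicative.Build ZxZ Zmul l lM).
  have E : lm \o K =1 @one_fun (enveloping_group Q) Zmul.
    by apply: enveloping_hom_eq => x /=; rewrite Kp.
  by have := E (L q); rewrite /= LK.
(* The form with coefficients [(- p.2, p.1)] vanishes at [p], which forces [p = 0]; then the first
   projection vanishes at [p] but not at [e1]. *)
have := lin (- p.2)%R p.1; rewrite mulrN mulrC addNr => /(_ erefl) lp.
have := lp e1; have := lp e2; rewrite /= !mul1r !mul0r addr0 add0r => p1 /eqP.
rewrite oppr_eq0 => /eqP p2.
have := lin 1%R 0%R; rewrite p1 p2 !mul0r => /(_ erefl e1).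
by rewrite /= mulr1 mulr0.
Qed.

(** [gen_not_const] rules out an empty [Q] and a single orbit; a third orbit would make three
    indicator functions independent in rank 2. *)
Lemma two_orbits : exists a b, ~~ qconn a b /\ forall c, qconn a c || qconn b c.
Proof.
have [a _ | Q0] := pickP (@predT Q); last first.
  by case: (@gen_not_const 1) => x; have := Q0 x.
have [b nab | Qa] := pickP (fun b => ~~ qconn a b); last first.
  case: (@gen_not_const (K (gen a))) => x; congr (K _); apply/esym.
  by apply: (qconn_invariant gen_op); move/negbFE: (Qa x).
exists a, b; split=> // c; apply/negPn/negP; rewrite negb_or => /andP[nac nbc].
have inv x : forall y z, (qconn x (y * z)%quandle : int) = qconn x y.
  by move=> y z; rewrite qconn_op.
(* The matrix of [qconn] on [a], [b], [c] is the identity, but it has rank at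
   most 2. *)
have [u1 [v1 E1]] := invariant_rank2 (inv a).
have [u2 [v2 E2]] := invariant_rank2 (inv b).
have [u3 [v3 E3]] := invariant_rank2 (inv c).
(* Cofactor expansion of the determinant of a 3 x 2 matrix times a 2 x 3 matrix. *)
have det0 (p1 p2 q1 q2 r1 r2 : int) :
  ((p1 * u1 + p2 * v1) * ((q1 * u2 + q2 * v2) * (r1 * u3 + r2 * v3)
                          - (r1 * u2 + r2 * v2) * (q1 * u3 + q2 * v3))
   - (q1 * u1 + q2 * v1) * ((p1 * u2 + p2 * v2) * (r1 * u3 + r2 * v3)
                            - (r1 * u2 + r2 * v2) * (p1 * u3 + p2 * v3))
   + (r1 * u1 + r2 * v1) * ((p1 * u2 + p2 * v2) * (q1 * u3 + q2 * v3)
                            - (q1 * u2 + q2 * v2) * (p1 * u3 + p2 * v3)) = 0)%R.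
  by ring.
have := det0 (K (gen a)).1 (K (gen a)).2 (K (gen b)).1 (K (gen b)).2
  (K (gen c)).1 (K (gen c)).2.
rewrite -!E1 -!E2 -!E3 /qconn !connect0 -/qconn.
by rewrite !(qconn_sym b a) !(qconn_sym c) (negPf nab) (negPf nac) (negPf nbc).
Qed.

End Orbits.

Theorem theorem3p3 (Q : finQuandleType) :
  group_iso (enveloping_group Q) ZxZ <->
  exists n m : nat, [/\ 0 < n, 0 < m, coprime n m & quandle_iso Q (U n m)].
Proof.
split=> [[K [L KK LK]] | [n [m [n0 m0 co_nm [f [g fK gK] fM]]]]].
  have cG (g h : enveloping_group Q) : commute g h.
    by apply: (can_inj KK); rewrite !gmulfM; apply: ZxZ_commute.
  have [a [b [nab cover]]] := two_orbits cG KK LK.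
  have [n [m [n0 m0 [f f_bij fM]]]] := two_orbits_U cG nab cover.
  by exists n, m; split=> //; [apply: U_commute_coprime f_bij fM cG | exists f].
apply: (U_enveloping_ZxZ n0 m0 co_nm (f := g)) => [u v|]; last by exists f.
by apply: (can_inj fK); rewrite fM !gK.
Qed.
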